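(* Let $U$ be a star-shaped open region of an $n$-dimensional Riemannian manifold. The space $\mathcal{Y}(U)=\{\omega\in\Lambda(U):\omega=h\delta\omega\}$ of anticoexact forms is a $C^\infty(U)$-module (a $C^\infty(U)$-submodule of $\Lambda(U)$).
   Context: A star-shaped open region $U$ of a smooth manifold $M$ with $\dim M=n\ge 1$ is an open subset diffeomorphic to an open ball in $\mathbb{R}^n$; fix such a diffeomorphism, use the resulting coordinates $x=(x^1,\dots,x^n)$ on $U$, and fix $x_0\in U$. $\Lambda^k(U)$ denotes smooth $k$-forms on $U$ and $\Lambda(U)=\bigoplus_k\Lambda^k(U)$. $U$ is oriented and carries a Riemannian metric $g$ (arbitrary, not necessarily flat), with standard Hodge star $\star$. $\eta\omega=(-1)^p\omega$ for $\omega\in\Lambda^p(U)$. Codifferential: $\delta=\star^{-1}d\star\eta$ (zero on $0$-forms). Homotopy operator: with $\mathcal{K}=(x-x_0)^i\partial_i$ and $F(t,x)=x_0+t(x-x_0)$, for $\omega\in\Lambda^k(U)$, $k\ge1$, $$H\omega=\int_0^1 i_{\mathcal{K}}\,\omega|_{F(t,x)}\,t^{k-1}\,dt\in\Lambda^{k-1}(U),$$ where $\omega|_{F(t,x)}$ means that the coefficients of $\omega$ in the basis $dx^I$ are evaluated at $F(t,x)$ (the $dx^I$ unchanged) and $\mathcal{K}$ is taken at $x$; $H=0$ on $0$-forms. Cohomotopy operator: $h=\eta\star^{-1}H\star$, mapping $\Lambda^r(U)$ to $\Lambda^{r+1}(U)$ (zero on $n$-forms). *)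

(* Defs.v *)
From HB Require Import structures.
From mathcomp Require Import all_boot all_order all_algebra.
From mathcomp Require Import all_classical all_reals all_analysis.
Import Order.TTheory GRing.Theory Num.Theory.
Import numFieldNormedType.Exports.

Set Implicit Arguments.
Unset Strict Implicit.
Unset Printing Implicit Defensive.

Local Open Scope classical_set_scope.
Local Open Scope ring_scope.

Section Smoothness.
Context {R : realType} {n : nat}.
Implicit Types (B : set 'rV[R]_n) (f h : 'rV[R]_n -> R).

Definition partial (i : 'I_n) f : 'rV[R]_n -> R :=
  fun x => 'D_(delta_mx 0 i) f x.

(* The Euclidean ball; the norm of the library on 'rV[R]_n is the sup norm. *)
Definition eball (c : 'rV[R]_n) (r : R) : set 'rV[R]_n :=
  [set x | \sum_(i < n) (x 0 i - c 0 i) ^+ 2 < r ^+ 2].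

Fixpoint Ck B (k : nat) f : Prop :=
  (forall x, B x -> {for x, continuous f}) /\
  match k with
  | 0 => True
  | k'.+1 => forall i : 'I_n,
      (forall x, B x -> derivable f x (delta_mx 0 i)) /\ Ck B k' (partial i f)
  end.

Definition smooth_on B f : Prop := forall k, Ck B k f.

Lemma open_eball c r : open (eball c r).
Proof.
rewrite (_ : eball c r =
  (fun x : 'rV[R]_n => \sum_(i < n) (x 0 i - c 0 i) ^+ 2) @^-1`
    [set y | y < r ^+ 2]); last by [].
apply: open_comp; last exact: open_lt.
move=> x _; move: x; apply: continuous_big => [|i _ x]; first exact: add_continuous.
apply: (@continuous_comp _ _ _ (fun x : 'rV[R]_n => x 0 i - c 0 i)
  (fun y : R => y ^+ 2)); last exact: exprn_continuous.
by apply: continuousB; [exact: coord_continuous|exact: cst_continuous].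
Qed.

Lemma Ck_ext B k f h : open B -> (forall x, B x -> f x = h x) ->
  Ck B k f -> Ck B k h.
Proof.
move=> oB.
have near_fh (f' h' : 'rV[R]_n -> R) x :
    (forall y, B y -> f' y = h' y) -> B x -> {near x, f' =1 h'}.
  by move=> fh Bx; near=> y; apply: fh; near: y; exact: open_nbhs_nbhs.
have cont_fh (f' h' : 'rV[R]_n -> R) x :
    (forall y, B y -> f' y = h' y) -> B x ->
    {for x, continuous f'} -> {for x, continuous h'}.
  move=> fh Bx fx; rewrite /prop_for /continuous_at fh // in fx.
  exact: cvg_trans (near_eq_cvg (near_fh _ _ _ fh Bx)) fx.
elim: k f h => [|k IH] f h fh /= [cf df].
  by split=> // x Bx; exact: cont_fh fh Bx (cf _ Bx).
split=> [x Bx|i]; first exact: cont_fh fh Bx (cf _ Bx).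
have [di Ci] := df i; split=> [x Bx|].
  exact: (near_eq_derivable (near_fh _ _ _ fh Bx) (di _ Bx)).
apply: IH Ci => x Bx; exact: (near_eq_derive _ (near_fh _ _ _ fh Bx)).
Unshelve. all: by end_near.
Qed.

Lemma CkS B k f : Ck B k.+1 f -> Ck B k f.
Proof.
elim: k f => [|k IH] f /= [cf df]; first by [].
by split=> // i; have [di Ci] := df i; split=> //; exact: IH.
Qed.

Lemma Ck_cst B k (a : R) : Ck B k (fun=> a).
Proof.
elim: k a => [|k IH] a /=; (split; first by move=> x _; exact: cst_continuous).
  by [].
move=> i; split=> [x _|]; first exact: derivable_cst.
rewrite (_ : partial _ _ = fun=> 0); first exact: IH.
by apply/funext => x; rewrite /partial derive_cst.
Qed.

Lemma CkB B k f h : open B -> Ck B k f -> Ck B k h ->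
  Ck B k (fun x => f x - h x).
Proof.
move=> oB; elim: k f h => [|k IH] f h /= [cf df] [ch dh].
  by split=> // x Bx; apply: continuousB; [exact: cf|exact: ch].
split=> [x Bx|i]; first by apply: continuousB; [exact: cf|exact: ch].
have [dfi Cf] := df i; have [dhi Ch] := dh i; split=> [x Bx|].
  by apply: derivableB; [exact: dfi|exact: dhi].
apply: Ck_ext (IH _ _ Cf Ch) => // x Bx.
by rewrite /partial deriveB; [|exact: dfi|exact: dhi].
Qed.

Lemma CkM B k f h : open B -> Ck B k f -> Ck B k h ->
  Ck B k (fun x => f x * h x).
Proof.
move=> oB; elim: k f h => [|k IH] f h Cf Ch.
  have [[cf _] [ch _]] := (Cf, Ch).
  by split=> // x Bx; apply: continuousM; [exact: cf|exact: ch].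
have [[cf df] [ch dh]] := (Cf, Ch).
split=> [x Bx|i]; first by apply: continuousM; [exact: cf|exact: ch].
have [dfi Cfi] := df i; have [dhi Chi] := dh i; split=> [x Bx|].
  by apply: derivableM; [exact: dfi|exact: dhi].
have C0 := CkB oB (IH _ _ (CkS Cf) Chi)
  (CkB oB (@Ck_cst B k 0) (IH _ _ (CkS Ch) Cfi)).
apply: Ck_ext C0 => // x Bx.
rewrite /partial deriveM; [|exact: dfi|exact: dhi].
by rewrite sub0r opprK.
Qed.

End Smoothness.

(* A star-shaped open region of an n-manifold together with the fixed
   diffeomorphism [coord] onto an open ball of R^n, given with its inverse
   [point] (whose values outside the ball are irrelevant). The smooth structure
   of the region is the one that makes [coord] a diffeomorphism. *)
Record star_region (R : realType) (n : nat) := StarRegion {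
  carrier :> Type;
  centre : 'rV[R]_n;
  radius : R;
  radius_gt0 : 0 < radius;
  coord : carrier -> 'rV[R]_n;
  point : 'rV[R]_n -> carrier;
  coord_eball : forall u, eball centre radius (coord u);
  coordK : cancel coord point;
  pointK : forall y, eball centre radius y -> coord (point y) = y
}.

Section SmoothFunctions.
Context {R : realType} {n : nat}.
Variable U : star_region R n.

Definition is_smooth : {pred U -> R} :=
  fun f => `[< smooth_on (eball (centre U) (radius U)) (f \o point U) >].

Lemma is_smooth_subring : subring_closed is_smooth.
Proof.
have oB := @open_eball _ _ (centre U) (radius U).
split=> [|f h /asboolP sf /asboolP sh|f h /asboolP sf /asboolP sh];
  apply/asboolP => k.
- exact: (@Ck_cst _ _ _ k 1).
- exact: (CkB oB (sf k) (sh k)).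
- exact: (CkM oB (sf k) (sh k)).
Qed.

HB.instance Definition _ :=
  GRing.isSubringClosed.Build (U -> R) is_smooth is_smooth_subring.

Record Cinf := MkCinf { Cinf_val :> U -> R; Cinf_valP : Cinf_val \in is_smooth }.

HB.instance Definition _ := [isSub for Cinf_val].
HB.instance Definition _ := [Choice of Cinf by <:].
HB.instance Definition _ :=
  GRing.SubChoice_isSubComPzRing.Build _ _ Cinf (subringClosedP _).

(* Differential forms of mixed degree: [w I] is the coefficient of
   dx^I = dx^i1 /\ ... /\ dx^ik, where I = {i1 < ... < ik}. As a Cinf-module,
   this is the free module on the dx^I. *)
Definition forms := {ffun {set 'I_n} -> Cinf^o}.

HB.instance Definition _ := GRing.Lmodule.on forms.

End SmoothFunctions.

Section ExteriorAlgebra.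
Context {R : realType} {n : nat}.

(* The exterior algebra of a cotangent space, in the basis of the dx^I. *)
Definition ext := {ffun {set 'I_n} -> R}.

HB.instance Definition _ := GRing.Zmodule.on ext.

Implicit Types (I J : {set 'I_n}) (a b : ext) (G : 'M[R]_n) (o : bool).

Definition dx I : ext := [ffun J : {set 'I_n} => (J == I)%:R].

(* dx^I /\ dx^J = shuffle_sign I J * dx^(I :|: J) for disjoint I and J. *)
Definition shuffle_sign I J : R :=
  (-1) ^+ #|[set p : 'I_n * 'I_n | [&& p.1 \in I, p.2 \in J & (p.2 < p.1)%N]]|.

Definition wedge a b : ext :=
  [ffun J : {set 'I_n} => \sum_(I : {set 'I_n} | I \subset J)
     shuffle_sign I (J :\: I) * a I * b (J :\: I)].

Definition interior (v : 'rV[R]_n) a : ext :=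
  [ffun I : {set 'I_n} => \sum_(i < n | i \notin I)
     shuffle_sign [set i] I * v 0 i * a (i |: I)].

Definition grading a : ext := [ffun I : {set 'I_n} => (-1) ^+ #|I| * a I].

(* Meant for #|I| = #|J|, rows and columns being taken in increasing order; the
   default value of [nth] is then never used. *)
Definition minor (A : 'M[R]_n) I J : R :=
  \det (\matrix_(p < #|I|, q < #|I|)
    A (enum_val p) (nth (enum_val q) (enum J) q)).

(* The inner product of forms induced by the Gram matrix G of the metric in the
   basis of the coordinate vector fields: <dx^i, dx^j> = (G^-1)_ij, extended to
   each degree by determinants; forms of different degrees are orthogonal. *)
Definition inner G a b : R :=
  \sum_(I : {set 'I_n}) \sum_(J : {set 'I_n} | #|J| == #|I|)
    a I * b J * minor (invmx G) I J.

(* The coefficient of the volume form on dx^1 /\ ... /\ dx^n; [o] is [true] when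
   the coordinates are negatively oriented. *)
Definition volume o G : R := (-1) ^+ o * Num.sqrt (\det G).

(* The coefficients are read off from
   dx^(~: J) /\ hodge b = <dx^(~: J), b> vol; see [wedge_hodge]. *)
Definition hodge o G b : ext :=
  [ffun J : {set 'I_n} =>
     shuffle_sign (~: J) J * inner G (dx (~: J)) b * volume o G].

Definition hodge_inv o G : ext -> ext := 'pinv_(fun=> 0) setT (hodge o G).

Lemma inner_dx G a b :
  inner G a b = \sum_(I : {set 'I_n}) a I * inner G (dx I) b.
Proof.
rewrite {1}/inner; apply: eq_bigr => I _; rewrite /inner.
rewrite [X in _ = _ * X](bigD1 I) //= [X in _ * (_ + X)]big1 => [|K KI].
  rewrite addr0 mulr_sumr; apply: eq_bigr => J _.
  by rewrite ffunE eqxx mul1r mulrA.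
by apply: big1 => J _; rewrite ffunE (negbTE KI) !mul0r.
Qed.

(* For a and b of the same degree this is a /\ hodge b = <a, b> vol. *)
Lemma wedge_hodge o G a b :
  wedge a (hodge o G b) [set: 'I_n]%SET = inner G a b * volume o G.
Proof.
rewrite ffunE inner_dx mulr_suml; apply: eq_big => [I|I _].
  by rewrite finset.subsetT.
rewrite ffunE finset.setTD finset.setCK !mulrA; congr (_ * _).
rewrite -[_ * a I * _]mulrA [a I * _]mulrC mulrA /shuffle_sign -expr2 -exprM.
by rewrite mulnC exprM sqrrN !expr1n mul1r.
Qed.

End ExteriorAlgebra.

Arguments ext : clear implicits.

Section Operators.
Context {R : realType} {n : nat}.
Variables (U : star_region R n) (o : bool) (x0 : U) (g : 'M[Cinf U]_n).

(* The operators below act on arbitrary mixed-degree sections; that they vanish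
   on 0-forms or n-forms where they should is automatic in this encoding. *)
Implicit Types (w : U -> ext R n) (u : U).

Definition gram u : 'M[R]_n := \matrix_(i, j) g i j u.

Definition riemannian : Prop := forall u,
  (gram u)^T = gram u /\
  forall v : 'rV[R]_n, v != 0 -> 0 < (v *m gram u *m v^T) 0 0.

Definition section_of (a : forms U) : U -> ext R n :=
  fun u => [ffun I : {set 'I_n} => (a I : Cinf U) u].

Definition partial_section (i : 'I_n) w : U -> ext R n :=
  fun u => [ffun I : {set 'I_n} =>
    partial i (fun y => w (point U y) I) (coord u)].

Definition exterior_derivative w : U -> ext R n :=
  fun u => \sum_(i < n) wedge (dx [set i]%SET) (partial_section i w u).

Definition eta w : U -> ext R n := fun u => grading (w u).

Definition star w : U -> ext R n := fun u => hodge o (gram u) (w u).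

Definition star_inv w : U -> ext R n := fun u => hodge_inv o (gram u) (w u).

Definition codifferential w : U -> ext R n :=
  star_inv (exterior_derivative (star (eta w))).

Definition contraction (t : R) : 'rV[R]_n -> 'rV[R]_n :=
  fun x => coord x0 + t *: (x - coord x0).

(* The exponent k - 1 for the k-form part is the degree #|I| of the result. *)
Definition homotopy w : U -> ext R n :=
  fun u => [ffun I : {set 'I_n} =>
    \int[lebesgue_measure]_(t in `[0, 1])
      (interior (coord u - coord x0) (w (point U (contraction t (coord u)))) I
       * t ^+ #|I|)].

Definition cohomotopy w : U -> ext R n :=
  eta (star_inv (homotopy (star w))).

Definition anticoexact : {pred forms U} :=
  fun a : forms U =>
    `[< section_of a = cohomotopy (codifferential (section_of a)) >].

End Operators.

(* Main.v *)
(* Put alpha = star (eta omega). Since the Hodge star is invertible, omega = h delta omega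
   is equivalent to alpha = H d alpha. This holds if and only if i_K alpha = 0
   and alpha(x0) = 0: every H beta satisfies both conditions, because i_K i_K = 0 and
   K(x0) = 0. Conversely, i_K alpha = 0 turns Cartan's formula into
   i_K d alpha = sum_i K^i d_i alpha + k alpha, so that the integrand of H d alpha is the
   derivative of t^k alpha(F(t, x)). The two conditions are pointwise linear in omega. *)

From HB Require Import structures.
From mathcomp Require Import all_boot all_order all_algebra.
From mathcomp Require Import all_classical all_reals all_analysis.
From mathcomp Require Import fingroup perm ring lra.
Require Import Defs.
Import Order.TTheory GRing.Theory Num.Theory.
Import numFieldNormedType.Exports.

Set Implicit Arguments.
Unset Strict Implicit.
Unset Printing Implicit Defensive.

Local Open Scope classical_set_scope.
Local Open Scope ring_scope.

(** * Exterior algebra in coordinates *)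

(** Multiplication by a function f does not commute with d or H, so the equation omega = h delta
    omega does not show the module structure; the criterion on alpha replaces it by conditions at
    single points, where f is just a scalar. Its price is twofold. The inverse star is only a
    pseudo-inverse, so bijectivity must be proved: the star is an exterior power of the inverse Gram
    matrix up to complementation and a factor, Cauchy-Binet makes exterior powers multiplicative,
    and positive definiteness makes det G positive. Smoothness is given by iterated partial
    derivatives, so differentiability along rays has to be derived from continuity of the partials.
    The value alpha(x0) enters as the boundary term at t = 0, where t^k leaves only degree 0. *)

Section Cartan.
Context {R : realType} {n : nat}.

HB.instance Definition _ := GRing.Lmodule.copy (ext R n) {ffun {set 'I_n} -> R^o}.

Implicit Types (a b : ext R n) (I J : {set 'I_n}) (v : 'rV[R]_n).

Local Notation s i I := (@shuffle_sign R n [set i]%SET I).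

Lemma extZE (c : R) a I : (c *: a : ext R n) I = c * a I.
Proof. by rewrite ffunE. Qed.

Lemma extDE a b I : (a + b : ext R n) I = a I + b I.
Proof. by rewrite ffunE. Qed.

Lemma shuffle_sign1 i I :
  s i I = (-1) ^+ #|[set j in I | (j < i)%N]%SET|.
Proof.
rewrite /shuffle_sign; congr (_ ^+ _).
rewrite -(card_imset _ (fun j k (e : (i, j) = (i, k)) => congr1 snd e)).
apply: eq_card => -[k l]; apply/idP/imsetP => [|[j]].
  rewrite in_setE /= inE => /and3P[/eqP -> lI li]; by exists l; rewrite // inE lI.
by rewrite inE => /andP[jI ji] [-> ->]; apply/mem_set; rewrite /= inE eqxx jI.
Qed.

Lemma shuffle_sign1U i j J : j \notin J ->
  s i (j |: J)%SET = (-1) ^+ (j < i)%N * s i J.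
Proof.
move=> jJ; rewrite !shuffle_sign1 -exprD; congr (_ ^+ _).
case: ltnP => ji.
  rewrite (_ : [set k in _ | _] = j |: [set k in J | (k < i)%N])%SET.
    by rewrite cardsU1 inE (negbTE jJ).
  by apply/setP => k; rewrite !inE; case: eqP => // ->; rewrite ji.
rewrite add0n; apply: eq_card => k; rewrite !inE.
by case: eqP => // ->; rewrite ltnNge ji /= andbF.
Qed.

Lemma shuffle_sign1_sqr i I : s i I * s i I = 1.
Proof. by rewrite -expr2 /shuffle_sign sqrr_sign. Qed.

(** Anticommutation of dx^i and dx^j at the level of signs: exactly one of j < i and i < j holds, so
    exactly one of the two insertions flips a sign. *)
Lemma shuffle_sign1_anti i j J : i != j -> i \notin J -> j \notin J ->
  s i (j |: J)%SET * s j J = - (s j (i |: J)%SET * s i J).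
Proof.
move=> ij iJ jJ; rewrite !shuffle_sign1U //.
have : i != j :> nat by [].
by case: ltngtP => // _ _; rewrite !(expr0, expr1); ring.
Qed.

Lemma wedge1E i a J :
  wedge (dx [set i]%SET) a J =
  if i \in J then s i (J :\ i)%SET * a (J :\ i)%SET else 0.
Proof.
rewrite ffunE; case: ifP => iJ.
  rewrite (bigD1 [set i]%SET) ?finset.sub1set //= big1 => [|K /andP[_ Ki]].
    by rewrite addr0 ffunE eqxx mulr1.
  by rewrite ffunE (negbTE Ki) mulr0 mul0r.
rewrite big1 // => K KJ; rewrite ffunE; case: eqP => [Ki|]; last first.
  by rewrite mulr0 mul0r.
by rewrite Ki finset.sub1set iJ in KJ.
Qed.

Lemma interior_linear v : linear (interior v : ext R n -> ext R n).
Proof.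
move=> c a b; apply/ffunP => I; rewrite extDE extZE !ffunE mulr_sumr -big_split.
by apply: eq_bigr => i _ /=; rewrite extDE extZE; ring.
Qed.

HB.instance Definition _ v :=
  GRing.isLinear.Build R (ext R n) (ext R n) _ (interior v) (interior_linear v).

Lemma interiorZl c v a : interior (c *: v) a = c *: interior v a.
Proof.
apply/ffunP => I; rewrite extZE !ffunE mulr_sumr; apply: eq_bigr => i _.
by rewrite mxE; ring.
Qed.

Lemma interior_delta i a I :
  interior (delta_mx 0 i) a I =
  if i \in I then 0 else s i I * a (i |: I)%SET.
Proof.
rewrite ffunE; case: ifP => iI.
  apply: big1 => j jI; rewrite mxE eqxx /=.
  by case: eqP => [e|]; [rewrite e iI in jI|rewrite mulr0 mul0r].
rewrite (bigD1 i) ?iI //= big1 => [|j /andP[_ /negbTE ji]].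
  by rewrite mxE !eqxx mulr1 addr0.
by rewrite mxE eqxx ji mulr0 mul0r.
Qed.

(** By [shuffle_sign1_anti] the summand of the double contraction is antisymmetric in (i, j). Spread
    over all pairs with a symmetric condition [P], the sum equals its own opposite. *)
Lemma interiorK v a : interior v (interior v a) = 0.
Proof.
apply/ffunP => I; rewrite !ffunE.
under eq_bigr do rewrite ffunE mulr_sumr.
pose F (i j : 'I_n) := s i I * v 0 i *
   (s j (i |: I)%SET * v 0 j * a (j |: (i |: I))%SET).
pose P (i j : 'I_n) := [&& i \notin I, j \notin I & i != j].
have E : \sum_(i < n | i \notin I) \sum_(j < n | j \notin (i |: I)%SET) F i j =
    \sum_i \sum_j if P i j then F i j else 0.
  rewrite big_mkcond; apply: eq_bigr => i _; rewrite big_mkcond /P.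
  case: (i \in I) => /=; first by rewrite big1.
  by apply: eq_bigr => j _; rewrite !inE negb_or andbC (eq_sym i).
rewrite [LHS]E; set S := LHS.
have : S = - S.
  rewrite {1}/S exchange_big -sumrN; apply: eq_bigr => i _.
  rewrite -sumrN; apply: eq_bigr => j _.
  rewrite {1}/P (eq_sym j) andbCA -/(P i j).
  case: ifP => [/and3P[iI jI ij]|_]; last by rewrite oppr0.
  have e := shuffle_sign1_anti ij iI jI.
  rewrite /F (finset.setUCA [set i]%SET).
  set A := a _; transitivity (v 0 j * v 0 i * A *
    (s i (j |: I)%SET * s j I)); first by ring.
  by rewrite e; ring.
by move=> SN; lra.
Qed.

Lemma interior_wedge1 v i a I :
  interior v (wedge (dx [set i]%SET) a) I =
  v 0 i * a I - wedge (dx [set i]%SET) (interior v a) I.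
Proof.
rewrite wedge1E; case: (boolP (i \in I)) => iI; last first.
  rewrite ffunE subr0 (bigD1 i) //= wedge1E finset.setU11.
  rewrite finset.setU1K // big1 => [|k /andP[kI ki]].
    by rewrite addr0 mulrACA shuffle_sign1_sqr mul1r.
  by rewrite wedge1E !inE eq_sym (negbTE ki) (negbTE iI) mulr0.
have [J iJ ->] : exists2 J : {set 'I_n}, i \notin J & I = (i |: J)%SET.
  by exists (I :\ i)%SET; rewrite ?finset.setD1K // !inE eqxx.
rewrite finset.setU1K // !ffunE [in RHS](bigD1 i iJ) /= mulrDr opprD addrA.
rewrite !mulrA shuffle_sign1_sqr mul1r subrr add0r mulr_sumr -sumrN.
apply: eq_big => [k|k]; first by rewrite !inE negb_or andbC.
rewrite !inE negb_or => /andP[ki kJ].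
rewrite wedge1E !inE eqxx orbT.
have -> : ((k |: (i |: J)) :\ i)%SET = (k |: J)%SET.
  by rewrite finset.setUCA finset.setU1K // !inE negb_or eq_sym ki.
have e := shuffle_sign1_anti ki kJ iJ.
(* Insert the square of a sign so that the product expected by [shuffle_sign1_anti] appears. *)
rewrite -[LHS]mul1r -(shuffle_sign1_sqr i J).
transitivity ((s k (i |: J)%SET * s i J) * s i J * v 0 k *
  (s i (k |: J)%SET * a (k |: J)%SET)); first by ring.
rewrite e.
transitivity (- (s i (k |: J)%SET * s i (k |: J)%SET) *
  (s i J * s k J * v 0 k * a (k |: J)%SET)); first by ring.
by rewrite shuffle_sign1_sqr; ring.
Qed.

(** The number operator: each i in I removes and reinserts dx^i with the same sign and so
    contributes one copy of [a I]. It is the source of the term k alpha in Cartan's formula. *)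
Lemma sum_wedge_interior a I :
  (\sum_i wedge (dx [set i]%SET) (interior (delta_mx 0 i) a) : ext R n) I =
  #|I|%:R * a I.
Proof.
rewrite sum_ffunE.
under eq_bigr do rewrite wedge1E interior_delta !inE eqxx /=.
rewrite -big_mkcond /= -sum1_card natr_sum mulr_suml.
apply: eq_bigr => i iI; rewrite mulrA shuffle_sign1_sqr.
by rewrite !mul1r finset.setD1K.
Qed.

(** Algebraic core of Cartan's formula: [D i] stands for the i-th partial derivative of [a] and [v]
    for the radial field; the hypothesis has the shape obtained by differentiating i_K a = 0 along
    x^i. *)
Lemma interior_exterior v (D : 'I_n -> ext R n) a I :
  (forall i, interior v (D i) = - interior (delta_mx 0 i) a) ->
  interior v (\sum_i wedge (dx [set i]%SET) (D i) : ext R n) I =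
  \sum_i v 0 i * D i I + #|I|%:R * a I.
Proof.
move=> vD; rewrite linear_sum sum_ffunE.
under eq_bigr do rewrite interior_wedge1 vD.
rewrite big_split /=; congr (_ + _).
rewrite -sum_wedge_interior sum_ffunE; apply: eq_bigr => i _.
by rewrite !wedge1E; case: ifP; rewrite ?oppr0 // ffunE mulrN opprK.
Qed.

End Cartan.

(** * Cauchy-Binet and invertibility of the Hodge star *)

Section CauchyBinet.
Context {R : comNzRingType} {k n : nat}.
Variables (A : 'M[R]_(k, n)) (B : 'M[R]_(n, k)).

Lemma det_mulmx_sum_ffun :
  \det (A *m B) = \sum_(f : {ffun 'I_k -> 'I_n})
    (\prod_i A i (f i)) * \det (rowsub f B).
Proof.
rewrite /determinant.
under eq_bigr => s _.
  under [X in _ * X]eq_bigr do rewrite mxE.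
  rewrite bigA_distr_bigA /= mulr_sumr; over.
rewrite exchange_big; apply: eq_bigr => f _.
rewrite mulr_sumr; apply: eq_bigr => s _; rewrite big_split /= mulrCA.
by congr (_ * (_ * _)); apply: eq_bigr => i _; rewrite mxE.
Qed.

Lemma det_rowsub_noninj (f : 'I_k -> 'I_n) :
  ~~ injectiveb f -> \det (rowsub f B) = 0.
Proof.
case/injectivePn => i [j ij fij]; apply: (determinant_alternate ij) => l.
by rewrite !mxE fij.
Qed.

Lemma det_rowsub_perm (f : 'I_k -> 'I_n) (s : {perm 'I_k}) :
  \det (rowsub (f \o s) B) = (-1) ^+ s * \det (rowsub f B).
Proof.
rewrite -det_perm -det_mulmx -row_permE; congr (\det _).
by apply/matrixP => i j; rewrite !mxE.
Qed.

(** In the multilinear expansion over all maps f, non-injective ones repeat a row and vanish.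
    Injective ones are grouped by their image J; those are [e J] composed with the permutations,
    whose signs reassemble the determinant of the selected columns of [A]. Any enumeration [e] of
    the sets of size k will do. *)
Lemma cauchy_binet (e : {set 'I_n} -> 'I_k -> 'I_n) :
  (forall J : {set 'I_n}, #|J| = k -> injective (e J)) ->
  (forall (J : {set 'I_n}) i, #|J| = k -> e J i \in J) ->
  \det (A *m B) = \sum_(J : {set 'I_n} | #|J| == k)
    \det (colsub (e J) A) * \det (rowsub (e J) B).
Proof.
move=> einj eJ; rewrite det_mulmx_sum_ffun.
rewrite (bigID (fun f : {ffun 'I_k -> 'I_n} => injectiveb f)) /=.
rewrite [X in _ + X]big1 ?addr0 => [|f fN]; last first.
  by rewrite det_rowsub_noninj ?mulr0.
rewrite (partition_big (fun f : {ffun 'I_k -> 'I_n} => [set f i | i : 'I_k]%SET)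
  (fun J => #|J| == k)) /= => [|f /injectiveP finj]; last first.
  by rewrite card_imset ?card_ord.
apply: eq_bigr => J /eqP Jk.
pose h (s : {perm 'I_k}) : {ffun 'I_k -> 'I_n} := [ffun i => e J (s i)].
have hinj : injective h.
  move=> s t /ffunP st; apply/permP => i; apply: (einj J Jk).
  by have := st i; rewrite !ffunE.
have imeJ : [set e J i | i : 'I_k]%SET = J.
  apply/eqP; rewrite eqEcard card_imset ?card_ord ?Jk ?leqnn ?andbT; last exact: einj.
  by apply/fintype.subsetP => _ /imsetP[i _ ->]; exact: eJ.
rewrite (eq_bigl (fun f => f \in [set h s | s : {perm 'I_k}]%SET)) => [|f]; last first.
  apply/andP/imsetP => [[/injectiveP finj /eqP fJ]|[s _ ->]].
    have /fin_all_exists[s sP] : forall i, exists j, f i = e J j.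
      move=> i; have : f i \in [set e J j | j : 'I_k]%SET by rewrite imeJ -fJ imset_f.
      by case/imsetP => j _ ->; exists j.
    have sinj : injective s by move=> i j sij; apply: finj; rewrite !sP sij.
    by exists (perm sinj) => //; apply/ffunP => i; rewrite ffunE permE sP.
  split; first by apply/injectiveP => i j; rewrite !ffunE => /(einj J Jk)/perm_inj.
  rewrite eqEcard Jk card_imset ?card_ord ?leqnn ?andbT.
    by apply/fintype.subsetP => _ /imsetP[i _ ->]; rewrite ffunE eJ.
  by move=> i j; rewrite !ffunE => /(einj J Jk)/perm_inj.
rewrite big_imset /=; last by move=> s t _ _ /hinj.
rewrite {2}/determinant mulr_suml.
apply: eq_big => [s|s _]; first by rewrite inE.
rewrite (_ : rowsub (h s) B = rowsub (e J \o s) B); last first.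
  by apply/matrixP => i j; rewrite !mxE ffunE.
rewrite det_rowsub_perm mulrA [_ * (-1) ^+ _]mulrC.
by congr (_ * _ * _); apply: eq_bigr => i _; rewrite mxE ffunE.
Qed.

End CauchyBinet.

(** * Exterior powers of a matrix and invertibility of the Hodge star *)

Section Compound.
Context {R : realType} {n : nat}.
Variable i0 : 'I_n.
Implicit Types (A B G : 'M[R]_n) (I J K : {set 'I_n}).

(** A common default [i0] and a free size k turn minors on different index sets into determinants of
    matrices of one type. *)
Lemma minorE k A I J : #|I| = k -> #|J| = k ->
  minor A I J =
  \det (\matrix_(p < k, q < k) A (nth i0 (enum I) p) (nth i0 (enum J) q)).
Proof.
move=> <- JI; congr (\det _); apply/matrixP => p q; rewrite !mxE.
rewrite (enum_val_nth i0); congr (A _ _).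
by apply: set_nth_default; rewrite -cardE JI.
Qed.

Lemma minorM A B I K : #|K| = #|I| ->
  minor (A *m B) I K =
  \sum_(J : {set 'I_n} | #|J| == #|I|) minor A I J * minor B J K.
Proof.
move=> KI; rewrite (@minorE #|I|) //.
pose e J (q : 'I_#|I|) := nth i0 (enum J) q.
have eJ J i : #|J| = #|I| -> e J i \in J.
  by move=> JI; rewrite -mem_enum mem_nth // -cardE JI.
have einj J : #|J| = #|I| -> injective (e J).
  move=> JI p q /eqP; rewrite /e nth_uniq ?enum_uniq -?cardE ?JI //.
  by move=> /eqP /val_inj.
rewrite (_ : \matrix_(p, q) _ = rowsub (e I) A *m colsub (e K) B); last first.
  by apply/matrixP => p q; rewrite !mxE; apply: eq_bigr => j _; rewrite !mxE.
rewrite (cauchy_binet _ _ einj eJ); apply: eq_bigr => J /eqP JI.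
rewrite (minorE (k := #|I|) A) // (minorE (k := #|I|) B) //.
by congr (_ * _); congr (\det _); apply/matrixP => p q; rewrite !mxE.
Qed.

Lemma minor1 I K : #|K| = #|I| -> minor (1%:M : 'M[R]_n) I K = (I == K)%:R.
Proof.
move=> KI; rewrite (@minorE #|I|) //; case: eqP => [<-|/eqP IK].
  rewrite (_ : \matrix_(p, q) _ = 1%:M) ?det1 //.
  apply/matrixP => p q; rewrite !mxE; congr (_%:R).
  by rewrite nth_uniq ?enum_uniq -?cardE.
(* An index of I outside K gives a zero row. *)
have [i iI iK] : exists2 i, i \in I & i \notin K.
  apply/fintype.subsetPn; apply: contra IK => IK.
  by rewrite eqEcard IK KI leqnn.
have ip : (index i (enum I) < #|I|)%N by rewrite cardE index_mem mem_enum.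
rewrite (expand_det_row _ (Ordinal ip)) big1 // => q _.
rewrite !mxE /= nth_index ?mem_enum //; case: eqP => [iq|]; last by rewrite mul0r.
by rewrite iq -mem_enum mem_nth // -cardE KI in iK.
Qed.

(** The exterior powers of [A] in all degrees at once, acting on coefficients. *)
Definition compound A (b : ext R n) : ext R n :=
  [ffun I : {set 'I_n} =>
    \sum_(J : {set 'I_n} | #|J| == #|I|) minor A I J * b J].

Lemma compoundM A B b : compound A (compound B b) = compound (A *m B) b.
Proof.
apply/ffunP => I; rewrite !ffunE.
under eq_bigr => J /eqP JI do rewrite ffunE mulr_sumr JI.
rewrite exchange_big; apply: eq_bigr => K /eqP KI.
by rewrite minorM // mulr_suml; apply: eq_bigr => J _; rewrite mulrA.
Qed.

Lemma compound1 b : compound 1%:M b = b.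
Proof.
apply/ffunP => I; rewrite ffunE (bigD1 I) //= big1 => [|J /andP[/eqP JI IJ]].
  by rewrite addr0 minor1 // eqxx mul1r.
by rewrite minor1 // eq_sym (negbTE IJ) mul0r.
Qed.

Lemma compoundP A c a b I :
  compound A (c *: a + b) I = c * compound A a I + compound A b I.
Proof.
rewrite !ffunE mulr_sumr -big_split.
by apply: eq_bigr => J _ /=; rewrite extDE extZE; ring.
Qed.

Lemma posdef_det_neq0 G :
  (forall v : 'rV[R]_n, v != 0 -> 0 < (v *m G *m v^T) 0 0) -> \det G != 0.
Proof.
move=> Gpos; apply/negP => /det0P[v v0 vG].
by have := Gpos v v0; rewrite vG mul0mx mxE ltxx.
Qed.

(* The segment from the identity to G consists of positive definite matrices,
   so that the determinant does not vanish on it. *)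
Lemma posdef_det_gt0 G :
  (forall v : 'rV[R]_n, v != 0 -> 0 < (v *m G *m v^T) 0 0) -> 0 < \det G.
Proof.
(* The determinant along the segment as a polynomial in t, so that the intermediate value theorem
   for polynomials applies; it is used for [- p], which goes from -1 to a nonnegative value. *)
move=> Gpos; pose p : {poly R} :=
  \det (map_mx polyC 1%:M + 'X *: map_mx polyC (G - 1%:M)).
have pE t : p.[t] = \det (1%:M + t *: (G - 1%:M)).
  rewrite -/(horner_eval t p) -det_map_mx; congr (\det _).
  by apply/matrixP => i j; rewrite !mxE /= /horner_eval !hornerE.
rewrite lt_neqAle eq_sym posdef_det_neq0 //= leNgt; apply/negP => G0.
have [|t] := @poly_ivt R (- p) 0 1 ler01.
  rewrite !hornerN !pE scale0r addr0 det1 scale1r addrCA subrr addr0.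
  by rewrite oppr_le0 ler01 oppr_ge0 ltW.
move=> /andP[t0 t1]; rewrite rootN /root pE; apply/negP.
apply: posdef_det_neq0 => v v0.
have v2 : 0 < (v *m v^T) 0 0.
  have [i vi] : exists i, v 0 i != 0 by apply/rV0Pn.
  rewrite mxE (bigD1 i) //= mxE ltr_pwDl //.
    by rewrite -expr2 lt_neqAle sqr_ge0 eq_sym sqrf_eq0 vi.
  by apply: sumr_ge0 => j _; rewrite mxE -expr2 sqr_ge0.
have -> : v *m (1%:M + t *: (G - 1%:M)) *m v^T =
    (1 - t) *: (v *m v^T) + t *: (v *m G *m v^T).
  rewrite mulmxDr mulmx1 -scalemxAr mulmxBr mulmx1 mulmxDl -scalemxAl mulmxBl.
  by rewrite scalerBr scalerBl scale1r addrA addrAC.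
rewrite mxE [X in X + _]mxE [X in _ + X]mxE.
move: v2 (Gpos v v0); set b := (_ *m _) _ _; set a := (_ *m _) _ _ => b0 a0.
(* Only one of the weights 1 - t and t need be positive; comparing t with 1/2 tells which. *)
have [t2|t2] := leP t (2^-1).
  by apply: ltr_pwDl; [apply: mulr_gt0 => //; lra|apply: mulr_ge0 => //; exact: ltW].
by apply: ltr_wpDl; [apply: mulr_ge0; [lra|exact: ltW]|apply: mulr_gt0 => //; lra].
Qed.

Section Hodge.
Variables (o : bool) (G : 'M[R]_n).

(** The star as an exterior power of the inverse Gram matrix, followed by complementation and a
    scalar factor. Its linearity, invertibility and smoothness are all read off from this form. *)
Lemma hodgeE b J : hodge o G b J =
  shuffle_sign (~: J) J * volume o G * compound (invmx G) b (~: J)%SET.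
Proof.
rewrite !ffunE mulrAC; congr (_ * _); rewrite /inner (bigD1 (~: J)%SET) //=.
rewrite [X in _ + X]big1 ?addr0 => [|I /negbTE IJ].
  by apply: eq_bigr => K _; rewrite ffunE eqxx mul1r mulrC.
by apply: big1 => K _; rewrite ffunE IJ !mul0r.
Qed.

Lemma hodge_linear : linear (hodge o G : ext R n -> ext R n).
Proof.
move=> c a b; apply/ffunP => J; rewrite extDE extZE !hodgeE compoundP; ring.
Qed.

HB.instance Definition _ :=
  GRing.isLinear.Build R (ext R n) (ext R n) _ (hodge o G) hodge_linear.

Hypothesis Gpos : forall v : 'rV[R]_n, v != 0 -> 0 < (v *m G *m v^T) 0 0.

Lemma volume_neq0 : volume o G != 0.
Proof.
by rewrite mulf_neq0 ?signr_eq0 // gt_eqF // sqrtr_gt0 posdef_det_gt0.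
Qed.

Lemma hodge_bij : bijective (hodge o G).
Proof.
have Gu : G \in unitmx by rewrite unitmxE unitfE posdef_det_neq0.
pose tau (J : {set 'I_n}) := shuffle_sign (~: J) J * volume o G.
have tau0 J : tau J != 0.
  by rewrite mulf_neq0 ?volume_neq0 // /shuffle_sign signr_eq0.
(* Undo [hodgeE] from the outside in: the factor [tau] and the complement, then the exterior power
   of [invmx G]. *)
pose inv (c : ext R n) : ext R n :=
  compound G [ffun K : {set 'I_n} => (tau (~: K)%SET)^-1 * c (~: K)%SET].
exists inv.
  move=> b; rewrite -[RHS]compound1 -(mulmxV Gu) -compoundM /inv.
  congr (compound G _).
  apply/ffunP => K; rewrite ffunE hodgeE -/(tau _) mulrA mulVf // mul1r.
  by rewrite finset.setCK.
move=> c; apply/ffunP => J; rewrite hodgeE /inv compoundM mulVmx // compound1 ffunE.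
by rewrite finset.setCK -/(tau _) mulrA mulfV // mul1r.
Qed.

(** A pseudo-inverse cancels on one side by injectivity (here) and on the other by surjectivity
    ([hodge_invK]). *)
Lemma hodgeK : cancel (hodge o G) (hodge_inv o G).
Proof.
move=> b; apply: pinvKV; last by rewrite in_setT.
by move=> x y _ _; exact: (bij_inj hodge_bij).
Qed.

Lemma hodge_invK : cancel (hodge_inv o G) (hodge o G).
Proof.
move=> b; apply: pinvK; apply/mem_set.
by have [f _ fK] := hodge_bij; exists (f b).
Qed.

End Hodge.
End Compound.

Section Grading.
Context {R : realType} {n : nat}.

Lemma grading_linear : linear (@grading R n : ext R n -> ext R n).
Proof.
move=> c a b; apply/ffunP => J; rewrite ffunE !extDE !extZE ![grading _ _]ffunE.
by ring.
Qed.

HB.instance Definition _ :=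
  GRing.isLinear.Build R (ext R n) (ext R n) _ (@grading R n) grading_linear.

Lemma gradingK : involutive (@grading R n).
Proof.
by move=> a; apply/ffunP => I; rewrite !ffunE mulrA -expr2 sqrr_sign mul1r.
Qed.

End Grading.

(** * Directional derivatives and smooth functions *)

Section Directional.
Context {R : realType} {V : normedModType R}.
Implicit Types (f : V -> R) (x v w : V).

(** The two difference quotients are the same function of h; this brings one-variable calculus to
    directional derivatives. *)
Lemma is_derive_line f x v (t d : R) :
  is_derive t 1 (fun s : R => f (x + s *: v)) d <->
  is_derive (x + t *: v) v f d.
Proof.
have E : (fun h : R => h^-1 *: (((fun s : R => f (x + s *: v)) \o shift t) (h *: 1) -
      f (x + t *: v))) =
    (fun h : R => h^-1 *: ((f \o shift (x + t *: v)) (h *: v) - f (x + t *: v))).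
  apply/funext => h /=; congr (_ *: (f _ - _)).
  by rewrite scaler1 scalerDl addrCA.
by split=> -[+ <-]; rewrite /derivable => c; split;
  rewrite /derivable /derive ?E // -?E.
Qed.

Lemma is_derive_line0 f x v (d : R) :
  is_derive (0 : R) 1 (fun s : R => f (x + s *: v)) d <-> is_derive x v f d.
Proof.
by split=> [/is_derive_line|H]; last apply/is_derive_line;
  rewrite scale0r addr0.
Qed.

Lemma is_derive_comp1 (phi : R -> R) f x v (d e : R) :
  is_derive (f x) 1 phi d -> is_derive x v f e -> is_derive x v (phi \o f) (d * e).
Proof.
move=> dphi /is_derive_line0 df; apply/is_derive_line0.
apply: (@is_derive1_comp _ phi (fun s : R => f (x + s *: v))) df.
by rewrite scale0r addr0.
Qed.

Lemma is_deriveZv f x v (c d : R) :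
  is_derive x v f d -> is_derive x (c *: v) f (c * d).
Proof.
move=> /is_derive_line0 df; apply/is_derive_line0.
rewrite (_ : (fun s : R => _) = (fun s : R => f (x + s *: v)) \o (c \*: id)).
  rewrite mulrC; apply: is_derive1_comp; first by rewrite /= scaler0.
  have := @is_deriveZ R R R id c 0 1 1 (is_derive_id _ _).
  by rewrite [_ *: 1]mulr1.
by apply/funext => s /=; rewrite scalerA mulrC.
Qed.

(** A mean value theorem insensitive to the sign of [h], since a difference quotient runs over both
    signs. *)
Lemma MVT_norm (g dg : R -> R) (h : R) :
  (forall s : R, `|s| <= `|h| -> is_derive s (1 : R) g (dg s)) ->
  exists2 c : R, `|c| <= `|h| & g h - g 0 = dg c * h.
Proof.
move=> dgP.
have [h0|h0] := leP 0 h.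
  have hs s : s \in `[0, h] -> `|s| <= `|h|.
    by rewrite in_itv /= => /andP[s0 sh]; rewrite !ger0_norm.
  have [||c ch e] := @MVT_segment R g dg 0 h h0.
  - by move=> s sh; apply/dgP/hs; exact: subset_itv_oo_cc sh.
  - by apply: derivable_within_continuous => s /hs /dgP[].
  by exists c; [exact: hs|rewrite e subr0].
have hs s : s \in `[h, 0] -> `|s| <= `|h|.
  by rewrite in_itv /= => /andP[s0 sh]; rewrite !ler0_norm ?lerN2 // ltW.
have [||c ch e] := @MVT_segment R g dg h 0 (ltW h0).
- by move=> s sh; apply/dgP/hs; exact: subset_itv_oo_cc sh.
- by apply: derivable_within_continuous => s /hs /dgP[].
by exists c; [exact: hs|rewrite -opprB e sub0r mulrN opprK].
Qed.

(* Go from x to x + h v and then, by the mean value theorem, to x + h v + h w. *)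
Lemma is_deriveDv f x v w : derivable f x v ->
  (\forall y \near x, derivable f y w) -> {for x, continuous ('D_w f)} ->
  is_derive x (v + w) f ('D_v f x + 'D_w f x).
Proof.
move=> dv dw cw.
suff : h^-1 *: ((f \o shift x) (h *: (v + w)) - f x) @[h --> (0:R)^'] -->
    'D_v f x + 'D_w f x.
  by move=> H; split; [apply/cvg_ex; eexists; exact: H|exact/cvg_lim].
rewrite (_ : (fun h : R => _) = (fun h =>
  h^-1 *: ((f \o shift x) (h *: v) - f x) +
  h^-1 *: (f (h *: v + x + h *: w) - f (h *: v + x)))); last first.
  apply/funext => h /=; rewrite -scalerDr; congr (_ *: _).
  rewrite [in RHS]addrC addrA subrK; congr (f _ - _).
  by rewrite scalerDr addrAC.
apply: cvgD; first exact: dv.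
apply/cvgrPdist_le => e e0.
have /nbhs_ballP[d /= d0 dP] : \forall y \near x,
    derivable f y w /\ `|'D_w f x - 'D_w f y| <= e.
  near=> y; split; first by near: y.
  by near: y; move/cvgrPdist_le : cw => /(_ _ e0).
near=> h.
have h0 : h != 0 by near: h; exact: nbhs_dnbhs_neq.
have inb s : `|s| <= `|h| -> ball x d (h *: v + x + s *: w).
  move=> sh; rewrite -ball_normE /= [_ + x]addrC -addrA opprD addNKr.
  rewrite normrN; apply: (@le_lt_trans _ _ (`|h| * (`|v| + `|w|))).
    rewrite (le_trans (ler_normD _ _)) // !normrZ mulrDr lerD2l.
    by rewrite ler_wpM2r.
  (* The added 1 keeps the divisor below positive even if v = w = 0. *)
  rewrite (@le_lt_trans _ _ (`|h| * (`|v| + `|w| + 1))) //.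
    by rewrite ler_wpM2l // lerDl.
  rewrite -ltr_pdivlMr ?ltr_wpDl ?addr_ge0 //.
  near: h; apply: dnbhs0_lt; rewrite divr_gt0 // ltr_wpDl // addr_ge0 //.
have [|c ch E] := @MVT_norm (fun s : R => f (h *: v + x + s *: w))
    (fun s => 'D_w f (h *: v + x + s *: w)) h.
  move=> s /inb /dP[ds _]; apply/is_derive_line; exact: derivableP.
rewrite scale0r addr0 in E; rewrite E.
have := (dP _ (inb _ ch)).2.
by rewrite /GRing.scale /= mulrCA mulVf // mulr1.
Unshelve. all: by end_near.
Qed.

End Directional.

(** * Closure properties of C^k functions on an open set *)

Section SmoothClosure.
Context {R : realType} {n : nat}.
Variables (B : set 'rV[R]_n) (oB : open B).
Implicit Types (f h : 'rV[R]_n -> R) (k : nat).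

Lemma Ck_continuous k f x : Ck B k f -> B x -> {for x, continuous f}.
Proof. by case: k => [|k] [cf _]; exact: cf. Qed.

(** [Ck] speaks only of the basis directions; any other direction is reached by adding its
    coordinates one at a time with [is_deriveDv]. Derivatives along rays rely on this. *)
Lemma Ck1_is_derive f x v : Ck B 1 f -> B x ->
  is_derive x v f (\sum_i v 0 i * partial i f x).
Proof.
move=> [_ df] Bx; rewrite {1}(row_sum_delta v); move: x Bx.
elim: (index_enum _) => [|i r IH] x Bx.
  by rewrite !big_nil; split; [exact: derivable0|exact: derive0].
have dZ y : B y -> is_derive y (v 0 i *: delta_mx 0 i) f (v 0 i * partial i f y).
  by move=> By; apply/is_deriveZv/derivableP; exact: (df i).1.
(* The new coordinate must be the second summand: [is_deriveDv] asks of it a continuous derivative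
   nearby, and of the partial sum only derivability at x. *)
rewrite !big_cons [X in is_derive _ X]addrC [_ + \sum_(j <- r) _]addrC.
have [dr <-] := IH x Bx; have [_ <-] := dZ x Bx.
have nB : \forall z \near x, B z by exact: open_nbhs_nbhs.
have nd : \forall y \near x, derivable f y (v 0 i *: delta_mx 0 i).
  by near=> y; have [] : is_derive y (v 0 i *: delta_mx 0 i) f (v 0 i * partial i f y)
    by apply: dZ; near: y.
apply: (is_deriveDv dr nd).
have : {for x, continuous (fun y => v 0 i * partial i f y)}.
  by apply: continuousM; [exact: cst_continuous|exact: (df i).2.1].
rewrite /prop_for /continuous_at; have [_ ->] := dZ x Bx => c.
suff e : {near x, (fun y => v 0 i * partial i f y) =1 'D_(v 0 i *: delta_mx 0 i) f}.
  exact: cvg_trans (near_eq_cvg e) c.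
near=> y; have [_ <- //] : is_derive y (v 0 i *: delta_mx 0 i) f (v 0 i * partial i f y).
by apply: dZ; near: y.
Unshelve. all: by end_near.
Qed.

Lemma CkD k f h : Ck B k f -> Ck B k h -> Ck B k (fun x => f x + h x).
Proof.
move=> Cf Ch; apply: Ck_ext (CkB oB Cf (CkB oB (@Ck_cst _ _ B k 0) Ch)) => //.
by move=> x _; rewrite sub0r opprK.
Qed.

Lemma Ck_sum (I : Type) (r : seq I) (P : pred I) (F : I -> 'rV[R]_n -> R) k :
  (forall i, P i -> Ck B k (F i)) -> Ck B k (fun x => \sum_(i <- r | P i) F i x).
Proof.
move=> CF; elim: r => [|i r IH].
  by apply: Ck_ext (@Ck_cst _ _ B k _) => // x _; rewrite big_nil.
case Pi: (P i); last by apply: Ck_ext IH => // x _; rewrite big_cons Pi.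
by apply: Ck_ext (CkD (CF _ Pi) IH) => // x _; rewrite big_cons Pi.
Qed.

Lemma Ck_prod (I : Type) (r : seq I) (P : pred I) (F : I -> 'rV[R]_n -> R) k :
  (forall i, P i -> Ck B k (F i)) -> Ck B k (fun x => \prod_(i <- r | P i) F i x).
Proof.
move=> CF; elim: r => [|i r IH].
  by apply: Ck_ext (@Ck_cst _ _ B k _) => // x _; rewrite big_nil.
case Pi: (P i); last by apply: Ck_ext IH => // x _; rewrite big_cons Pi.
by apply: Ck_ext (CkM oB (CF _ Pi) IH) => // x _; rewrite big_cons Pi.
Qed.

(** The derivative of 1/f is a polynomial in 1/f and f', so the order k+1 reduces to the order k of
    1/f itself; [Ck_sqrt] follows the same pattern. *)
Lemma CkV k f : (forall x, B x -> f x != 0) -> Ck B k f ->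
  Ck B k (fun x => (f x)^-1).
Proof.
move=> f0; elim: k => [|k IH] Cf.
  split=> // x Bx; apply: continuousV; [exact: f0|exact: Ck_continuous Cf Bx].
split=> [x Bx|i].
  apply: continuousV; [exact: f0|exact: Ck_continuous Cf Bx].
have [df Cdf] := Cf.2 i; have CV := IH (CkS Cf).
split=> [x Bx|]; first by apply: derivableV; [exact: f0|exact: df].
have := CkM oB (CkM oB CV CV) (CkB oB (@Ck_cst _ _ B k 0) Cdf).
apply: Ck_ext => // x Bx; rewrite /partial deriveV; [|exact: f0|exact: df].
by rewrite /GRing.scale /= sub0r mulrN mulNr expr2 invfM.
Qed.

Lemma Ck_sqrt k f : (forall x, B x -> 0 < f x) -> Ck B k f ->
  Ck B k (fun x => Num.sqrt (f x)).
Proof.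
move=> f0; have cs x : {for x, continuous f} ->
    {for x, continuous (fun y => Num.sqrt (f y))}.
  by move=> cf; apply: continuous_comp => //; exact: sqrt_continuous.
elim: k => [|k IH] Cf.
  by split=> // x Bx; apply/cs/(Ck_continuous Cf Bx).
split=> [x Bx|i]; first by apply/cs/(Ck_continuous Cf Bx).
have [df Cdf] := Cf.2 i; have CS := IH (CkS Cf).
have ds x : B x -> is_derive x (delta_mx 0 i) (Num.sqrt \o f)
    ((2 * Num.sqrt (f x))^-1 * partial i f x).
  move=> Bx; apply: is_derive_comp1; last exact/derivableP/df.
  by apply: is_derive1_sqrt; exact: f0.
split=> [x Bx|]; first by have [] := ds x Bx.
have C2 := CkV _ (CkM oB (@Ck_cst _ _ B k 2) CS).
have := CkM oB (C2 _) Cdf.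
move=> H; apply: Ck_ext (H _) => // x Bx; first by have [_ <-] := ds x Bx.
by rewrite mulf_neq0 // gt_eqF // sqrtr_gt0 f0.
Qed.

Lemma Ck_det m (M : 'rV[R]_n -> 'M[R]_m) k :
  (forall i j, Ck B k (fun x => M x i j)) -> Ck B k (fun x => \det (M x)).
Proof.
move=> CM; apply: Ck_sum => s _; apply: CkM => //; first exact: Ck_cst.
by apply: Ck_prod => i _; exact: CM.
Qed.

Lemma Ck_invmx m (M : 'rV[R]_n -> 'M[R]_m) k :
  (forall x, B x -> M x \in unitmx) ->
  (forall i j, Ck B k (fun x => M x i j)) ->
  forall i j, Ck B k (fun x => invmx (M x) i j).
Proof.
move=> Mu CM i j.
have C1 : Ck B k (fun x => (\det (M x))^-1).
  by apply: CkV (Ck_det CM) => x /Mu; rewrite unitmxE unitfE.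
have C2 : Ck B k (fun x => cofactor (M x) j i).
  apply: CkM => //; first exact: Ck_cst.
  apply: Ck_det => a b; have := CM (lift j a) (lift i b).
  by apply: Ck_ext => // x _; rewrite !mxE.
by apply: Ck_ext (CkM oB C1 C2) => // x /Mu Mx; rewrite /invmx Mx !mxE.
Qed.

End SmoothClosure.

(** * The homotopy operator on a ball *)

Section EuclideanBall.
Context {R : realType} {n : nat}.
Implicit Types (c x y v : 'rV[R]_n) (r t : R).

Lemma eball_convex c r x y t : eball c r x -> eball c r y ->
  0 <= t <= 1 -> eball c r (x + t *: (y - x)).
Proof.
rewrite /eball /= => Bx By /andP[t0 t1].
set S := fun z : 'rV[R]_n => \sum_(i < n) (z 0 i - c 0 i) ^+ 2.
apply: (@le_lt_trans _ _ ((1 - t) * S x + t * S y)).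
  rewrite /S !mulr_sumr -big_split; apply: ler_sum => i _ /=; rewrite !mxE.
  set a := x 0 i; set b := y 0 i; set d := c 0 i.
  (* This is exactly the gap in the convexity inequality for one squared coordinate. *)
  have : 0 <= t * (1 - t) * (a - b) ^+ 2.
    by rewrite mulr_ge0 ?sqr_ge0 // mulr_ge0 // subr_ge0.
  rewrite -subr_ge0 => H; rewrite [X in _ <= X](_ : _ = t * (1 - t) * (a - b) ^+ 2) //.
  by ring.
rewrite -/(S x) in Bx; rewrite -/(S y) in By.
have [->|t0'] := eqVneq t 0; first by rewrite subr0 mul1r mul0r addr0.
have : 0 < t by rewrite lt_neqAle eq_sym t0'.
by move=> tp; nra.
Qed.

Lemma is_derive_coord (x x0 v : 'rV[R]_n) k :
  is_derive x v (fun z : 'rV[R]_n => (z - x0) 0 k) (v 0 k).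
Proof.
apply/is_derive_line0.
rewrite (_ : (fun s : R => _) = cst ((x - x0) 0 k) + v 0 k \*: id); last first.
  apply/funext => s; rewrite !mxE /=.
  by transitivity (x 0 k - x0 0 k + v 0 k * s); [ring|].
have := @is_deriveD R R R (cst ((x - x0) 0 k)) (v 0 k \*: id) 0 1 _ _
  (is_derive_cst _ _ _) (is_deriveZ _ (is_derive_id _ _)).
by rewrite add0r [_ *: 1]mulr1.
Qed.

Lemma is_derive_big (I : Type) (r : seq I) (P : pred I) (F : I -> 'rV[R]_n -> R)
    (d : I -> R) x v :
  (forall i, P i -> is_derive x v (F i) (d i)) ->
  is_derive x v (fun z => \sum_(i <- r | P i) F i z) (\sum_(i <- r | P i) d i).
Proof.
move=> dF; elim: r => [|i r IH].
  rewrite big_nil (_ : (fun _ => _) = cst 0); first exact: is_derive_cst.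
  by apply/funext => z; rewrite big_nil.
rewrite big_cons; case Pi: (P i); last first.
  by rewrite (_ : (fun _ => _) = (fun z => \sum_(j <- r | P j) F j z)) //;
    apply/funext => z; rewrite big_cons Pi.
rewrite (_ : (fun _ => _) = F i + (fun z => \sum_(j <- r | P j) F j z)).
  exact: (is_deriveD (dF _ Pi) IH).
by apply/funext => z; rewrite big_cons Pi.
Qed.

End EuclideanBall.

Section UnitInterval.
Context {R : realType}.
Implicit Types f : R -> R.

Lemma continuous_integrable01 f : {within `[0, 1], continuous f} ->
  lebesgue_measure.-integrable `[0, 1] (EFin \o f).
Proof. by move=> cf; apply: continuous_compact_integrable => //; exact: segment_compact. Qed.

Lemma Rintegral_sum01 (I : Type) (r : seq I) (P : pred I) (F : I -> R -> R) :
  (forall i, {within `[0, 1], continuous F i}) ->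
  \int[lebesgue_measure]_(t in `[0, 1]) (\sum_(i <- r | P i) F i t) =
  \sum_(i <- r | P i) \int[lebesgue_measure]_(t in `[0, 1]) F i t.
Proof.
move=> cF; elim: r => [|i r IH].
  rewrite big_nil; under eq_Rintegral do rewrite big_nil.
  by rewrite Rintegral_cst // mul0r.
rewrite big_cons; under eq_Rintegral do rewrite big_cons.
case: (P i) => //; rewrite RintegralD ?IH //; first exact: continuous_integrable01.
rewrite (_ : EFin \o _ = (fun t => (\sum_(j <- r | P j) (F j t)%:E)%E)).
  by apply: integrable_sum => // j _; exact: continuous_integrable01.
by apply/funext => t /=; rewrite sumEFin.
Qed.

End UnitInterval.

(** * Fixed points of H d on a ball, in coordinates *)

Section Poincare.
Context {R : realType} {n : nat}.
Variables (c x0 : 'rV[R]_n) (r : R).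
Local Notation B := (eball c r).
Hypothesis Bx0 : B x0.
Variable A : 'rV[R]_n -> ext R n.
Hypothesis CA : forall I, Ck B 1 (fun y => A y I).

Let oB : open B := @open_eball R n c r.

Definition extd (y : 'rV[R]_n) : ext R n :=
  \sum_(i < n) wedge (dx [set i]%SET)
    [ffun I : {set 'I_n} => partial i (fun z => A z I) y].

Let integrand y I t : R :=
  interior (y - x0) (extd (x0 + t *: (y - x0))) I * t ^+ #|I|.

(** This is H d A, not H A: the exterior derivative is already inside [integrand]. *)
Definition cone_homotopy (y : 'rV[R]_n) : ext R n :=
  [ffun I : {set 'I_n} =>
    \int[lebesgue_measure]_(t in `[0, 1]) integrand y I t].

Lemma Ck0_interior_extd v I : Ck B 0 (fun z => interior v (extd z) I).
Proof.
have CE J : Ck B 0 (fun z => extd z J).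
  pose f z : R := \sum_(i < n | i \in J)
    shuffle_sign [set i] (J :\ i) * partial i (fun z => A z (J :\ i)%SET) z.
  apply: (@Ck_ext _ _ B 0 f _ oB) => [x _|].
    rewrite /extd sum_ffunE /f big_mkcond; apply: eq_bigr => i _.
    by rewrite wedge1E ffunE.
  apply: Ck_sum => // i _; apply: CkM => //; first exact: Ck_cst.
  by have [_ /(_ i)[]] := CA (J :\ i)%SET.
apply: (@Ck_ext _ _ B 0 (fun z => \sum_(i < n | i \notin I)
  shuffle_sign [set i] I * v 0 i * extd z (i |: I)%SET) _ oB) => [x _|].
  by rewrite ffunE.
by apply: Ck_sum => // i _; apply: CkM => //; exact: Ck_cst.
Qed.

Lemma continuous_ray (y : 'rV[R]_n) : continuous (fun t : R => x0 + t *: (y - x0)).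
Proof.
move=> t; apply: cvgD; first exact: cvg_cst.
by apply: cvgZr_tmp; exact: cvg_id.
Qed.

Lemma continuous_integrand y I : B y ->
  {within `[0, 1], continuous (integrand y I)}.
Proof.
move=> By; apply: continuous_in_subspaceT => t; rewrite in_setE /= in_itv /= => t01.
apply: cvgM; last exact: exprn_continuous.
apply: (@continuous_comp _ _ _ (fun t : R => x0 + t *: (y - x0))
  (fun z => interior (y - x0) (extd z) I)); first exact: continuous_ray.
apply: Ck_continuous (Ck0_interior_extd _ _) _.
exact: eball_convex.
Qed.

(** K is taken at the endpoint y and is constant in t, so the contraction passes under the integral
    and meets the one inside. *)
Lemma interior_cone_homotopy y : B y -> interior (y - x0) (cone_homotopy y) = 0.
Proof.
move=> By; apply/ffunP => I; rewrite !ffunE; set v := y - x0.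
transitivity (\int[lebesgue_measure]_(t in `[0, 1])
  \sum_(i < n | i \notin I) (shuffle_sign [set i] I * v 0 i * integrand y (i |: I)%SET t)).
  rewrite Rintegral_sum01 => [|i].
    apply: eq_bigr => i _; rewrite ffunE RintegralZl //.
    exact/continuous_integrable01/continuous_integrand.
  by move=> t; apply: cvgM; [exact: cvg_cst|exact: continuous_integrand].
rewrite (_ : (fun t => _) = cst 0); first by rewrite Rintegral_cst // mul0r.
apply/funext => t /=; have := congr1 (fun a : ext R n => a I)
  (interiorK v (extd (x0 + t *: v))).
(* All sets i |: I with i outside I have #|I| + 1 elements, so every term carries this same power of
   t. *)
rewrite !ffunE => /(congr1 (fun x => x * t ^+ #|I|.+1)).
rewrite mul0r mulr_suml => E; rewrite -[RHS]E; apply: eq_bigr => i iI.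
by rewrite /integrand cardsU1 iI mulrA.
Qed.

Section Radial.
Hypothesis A0 : forall y, B y -> interior (y - x0) (A y) = 0.

(* Differentiate the identity A0 along the i-th coordinate. *)
Lemma interior_partial y i : B y ->
  interior (y - x0) [ffun I : {set 'I_n} => partial i (fun z => A z I) y] =
  - interior (delta_mx 0 i) (A y).
Proof.
move=> By; apply/ffunP => I; rewrite [RHS]ffunE !ffunE.
apply/eqP; rewrite -addr_eq0 -big_split /=.
pose F z : R := interior (z - x0) (A z) I.
have : is_derive y (delta_mx 0 i) F 0.
  have : is_derive y (delta_mx 0 i) (fun=> 0 : R) 0 by exact: is_derive_cst.
  move=> [d <-].
  have e : {near y, (fun=> 0) =1 F}.
    have nB : \forall z \near y, B z by exact: open_nbhs_nbhs.
    by apply: filterS nB => z Bz; rewrite /F A0 // ffunE.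
  by split; [exact: near_eq_derivable e d|rewrite (near_eq_derive _ e)].
(* The same derivative by the product rule: differentiating z - x0 produces [delta_mx 0 i], hence
   the contraction of [A y] with it. *)
have : is_derive y (delta_mx 0 i) F (\sum_(k < n | k \notin I)
  (shuffle_sign [set k] I * (y - x0) 0 k * partial i (fun z => A z (k |: I)%SET) y
  + shuffle_sign [set k] I * (delta_mx 0 i : 'rV[R]_n) 0 k * A y (k |: I)%SET)).
  rewrite (_ : F = fun z => \sum_(k < n | k \notin I)
    shuffle_sign [set k] I * (z - x0) 0 k * A z (k |: I)%SET); last first.
    by apply/funext => z; rewrite /F ffunE.
  apply: is_derive_big => k _.
  have dk : is_derive y (delta_mx 0 i) (fun z => A z (k |: I)%SET)
     (partial i (fun z => A z (k |: I)%SET) y).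
    by apply: derivableP; have [_ /(_ i)[/(_ _ By)]] := CA (k |: I)%SET.
  have H := is_deriveM (is_deriveZ (shuffle_sign [set k] I)
    (is_derive_coord y x0 (delta_mx 0 i) k)) dk.
  refine (is_derive_eq H _).
  by rewrite [A y _ *: _]mulrC.
move=> [_ E] [_ E0]; rewrite -[X in _ == X]E0 E; apply/eqP.
by apply: eq_bigr => k _; rewrite ffunE.
Qed.

Lemma interior_extd y I : B y ->
  interior (y - x0) (extd y) I =
  \sum_i (y - x0) 0 i * partial i (fun z => A z I) y + #|I|%:R * A y I.
Proof.
move=> By; rewrite (interior_exterior _ (a := A y)) => [|i]; last exact: interior_partial.
by congr (_ + _); apply: eq_bigr => i _; rewrite ffunE.
Qed.

(* The integrand is the derivative of t ^+ #|I| * A (x0 + t *: (y - x0)) I. *)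
Lemma cone_homotopy_id y : A x0 finset.set0 = 0 -> B y -> A y = cone_homotopy y.
Proof.
move=> Ax0 By; apply/ffunP => I; rewrite ffunE; set m := #|I|; set v := y - x0.
pose F (t : R) : R := t ^+ m * A (x0 + t *: v) I.
pose dF (t : R) : R := t ^+ m * (\sum_i v 0 i * partial i (fun z => A z I) (x0 + t *: v))
  + m%:R * t ^+ m.-1 * A (x0 + t *: v) I.
have dFP (t : R) : 0 <= t <= 1 -> is_derive t (1 : R) F (dF t).
  move=> t01; have Bt : B (x0 + t *: v) by exact: eball_convex.
  have /is_derive_line dl := Ck1_is_derive oB v (CA I) Bt.
  have H := is_deriveM (is_deriveX m (is_derive_id t (1 : R))) dl.
  rewrite (_ : F = (id : R -> R) ^+ m * (fun s : R => A (x0 + s *: v) I)).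
    refine (is_derive_eq H _).
    by rewrite exprfctE [_ *: 1]mulr1 /dF /GRing.scale /= [A _ _ * _]mulrC.
  by apply/funext => s; rewrite /F mulrfctE exprfctE.
have cF (t : R) : 0 <= t <= 1 -> {for t, continuous F}.
  by move=> /dFP[d _]; apply: differentiable_continuous; exact/derivable1_diffP.
have := @continuous_FTC2 R (integrand y I) F 0 1 ltr01 (@continuous_integrand y I By).
rewrite /Rintegral => ->.
- rewrite -EFinB /= /F expr1n mul1r scale1r scale0r addr0 /v [x0 + _]addrC subrK /m.
  (* At t = 0 the factor t^m kills the boundary term unless I is empty; that coefficient is the one
     [Ax0] controls. *)
  have [->|I0] := eqVneq I finset.set0; first by rewrite Ax0 mulr0 subr0.
  by rewrite expr0n cards_eq0 (negbTE I0) mul0r subr0.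
- split.
  + by move=> t; rewrite in_itv /= => /andP[t0 t1]; have [] := @dFP t; rewrite ?ltW.
  + by apply: cvg_at_right_filter; apply: cF; rewrite lexx ler01.
  + by apply: cvg_at_left_filter; apply: cF; rewrite lexx ler01.
move=> t; rewrite in_itv /= => /andP[t0 t1].
have t01 : 0 <= t <= 1 by rewrite !ltW.
rewrite derive1E; have [_ ->] := dFP t t01.
(* At the point x0 + t v the radial vector of [interior_extd] is t v, while the integrand contracts
   with v; multiplying by the nonzero t reconciles them and turns m t^(m-1) into m t^m. *)
apply: (mulfI (lt0r_neq0 t0)); rewrite /integrand -/v mulrA.
have Bt : B (x0 + t *: v) by exact: eball_convex.
have := interior_extd I Bt; rewrite addrAC subrr add0r interiorZl extZE => ->.
rewrite /dF -/m mulrDr mulrDl; congr (_ + _).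
  rewrite mulrCA mulrC mulr_sumr; congr (_ * _); apply: eq_bigr => i _.
  by rewrite [(t *: v) 0 i]mxE mulrA.
rewrite !mulrA -[_ * A _ _ * _]mulrAC; congr (_ * _).
by case: (m) => [|m']; [rewrite mulr0 !mul0r|rewrite exprS mulrCA mulrA].
Qed.

End Radial.

Lemma cone_homotopy_fixed :
  (forall y, B y -> A y = cone_homotopy y) <->
  (forall y, B y -> interior (y - x0) (A y) = 0) /\ A x0 = 0.
Proof.
split=> [AH|[A0 Ax0] y By]; last first.
  by apply: cone_homotopy_id => //; rewrite Ax0 ffunE.
split=> [y By|]; first by rewrite AH // interior_cone_homotopy.
rewrite AH //; apply/ffunP => I; rewrite !ffunE.
rewrite (_ : integrand x0 I = cst 0); first by rewrite Rintegral_cst // mul0r.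
apply/funext => t; rewrite /integrand subrr -(scale0r (0 : 'rV[R]_n)) interiorZl.
by rewrite scale0r ffunE mul0r.
Qed.

End Poincare.

(** * Anticoexact forms *)

Section Anticoexact.
Context {R : realType} {n : nat}.
Hypothesis n_gt0 : (0 < n)%N.
Variables (U : star_region R n) (o : bool) (x0 : U) (g : 'M[Cinf U]_n).
Hypothesis hg : riemannian g.
Local Notation B := (eball (centre U) (radius U)).
Implicit Types (a : forms U) (u : U).

Let i0 : 'I_n := Ordinal n_gt0.
Let oB : open B := @open_eball R n (centre U) (radius U).
Let gpos u := (hg u).2.

(** The form alpha, as a plain function of the point; its smoothness is [Ck_star_eta]. *)
Definition star_eta a u : ext R n := hodge o (gram g u) (grading (section_of a u)).

Lemma section_ofP (f : Cinf U) a b u :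
  section_of (f *: a + b) u = f u *: section_of a u + section_of b u.
Proof. by apply/ffunP => I; rewrite extDE extZE !ffunE. Qed.

Lemma star_etaP (f : Cinf U) a b u : star_eta (f *: a + b) u = f u *: star_eta a u + star_eta b u.
Proof. by rewrite /star_eta section_ofP !linearP. Qed.

Lemma star_eta0 u : star_eta 0 u = 0.
Proof.
rewrite /star_eta (_ : section_of 0 u = 0) ?raddf0 //.
by apply/ffunP => I; rewrite !ffunE.
Qed.

Lemma Ck_Cinf (f : Cinf U) k : Ck B k (fun y => f (point U y)).
Proof. by have /asboolP/(_ k) := Cinf_valP f. Qed.

(** By [hodgeE] the coefficients are polynomial in those of [a], the entries of the inverse Gram
    matrix and the root of its determinant; positive definiteness makes the inverse and the root
    smooth. *)
Lemma Ck_star_eta a k I : Ck B k (fun y => star_eta a (point U y) I).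
Proof.
have Cg i j : Ck B k (fun y => gram g (point U y) i j).
  by apply: Ck_ext (Ck_Cinf (g i j) k) => // y _; rewrite mxE.
have Cdet : Ck B k (fun y => Num.sqrt (\det (gram g (point U y)))).
  apply: Ck_sqrt => // [y _|]; last exact: Ck_det.
  by apply: posdef_det_gt0; exact: gpos.
have Cw K : Ck B k (fun y => grading (section_of a (point U y)) K).
  apply: Ck_ext (CkM oB (@Ck_cst _ _ B k ((-1) ^+ #|K|)) (Ck_Cinf (a K) k)) => //.
  by move=> y _; rewrite !ffunE.
have Cm J K : Ck B k (fun y => minor (invmx (gram g (point U y))) J K).
  apply: Ck_det => // p q.
  have Ci : forall i j, Ck B k (fun y => invmx (gram g (point U y)) i j).
    apply: Ck_invmx => // y _; rewrite unitmxE unitfE.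
    by apply: posdef_det_neq0; exact: gpos.
  by apply: Ck_ext (Ci _ _) => // y _; rewrite mxE.
pose f y : R := shuffle_sign (~: I) I *
  ((-1) ^+ o * Num.sqrt (\det (gram g (point U y)))) *
  \sum_(K : {set 'I_n} | #|K| == #|(~: I)%SET|)
    minor (invmx (gram g (point U y))) (~: I) K *
    grading (section_of a (point U y)) K.
apply: (@Ck_ext _ _ B k f _ oB) => [y _|]; first by rewrite /star_eta hodgeE ffunE.
apply: CkM => //.
  by apply: CkM => //; [exact: Ck_cst|apply: CkM => //; exact: Ck_cst].
by apply: Ck_sum => // K _; apply: CkM.
Qed.

(** Written out, h delta is eta, inverse star, H, star, inverse star, d, star, eta. The inner pair
    of stars cancels, and the outer eta and inverse star move to the other side because eta is an
    involution. *)
Lemma anticoexact_homotopy a :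
  a \in anticoexact o x0 g <-> star_eta a = homotopy x0 (exterior_derivative (star_eta a)).
Proof.
rewrite unfold_in; split=> [/asboolP E|E]; last apply/asboolP.
  rewrite {1}/star_eta E; apply/funext => u.
  rewrite /cohomotopy /eta /star_inv gradingK (hodge_invK i0 _ (gpos u)).
  congr (homotopy x0 _ u); apply/funext => u'.
  by rewrite /codifferential /star /star_inv (hodge_invK i0 _ (gpos u')).
apply/funext => u; rewrite /cohomotopy /eta /star_inv.
have -> : star o g (codifferential o g (section_of a)) = exterior_derivative (star_eta a).
  apply/funext => u'.
  by rewrite /codifferential /star /star_inv (hodge_invK i0 _ (gpos u')).
by rewrite -E /star_eta (hodgeK i0 _ (gpos u)) gradingK.
Qed.

Lemma anticoexactP a : a \in anticoexact o x0 g <->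
  (forall u, interior (coord u - coord x0) (star_eta a u) = 0) /\ star_eta a x0 = 0.
Proof.
rewrite anticoexact_homotopy.
have Bx0 := coord_eball x0.
pose A y := star_eta a (point U y).
(* Coordinates and points correspond only on the ball, as [point] is arbitrary outside it; convexity
   keeps the contracted points inside. *)
have dA y : B y -> exterior_derivative (star_eta a) (point U y) = extd A y.
  by move=> By; rewrite /exterior_derivative /extd /partial_section pointK.
have hA u : homotopy x0 (exterior_derivative (star_eta a)) u =
    cone_homotopy (coord x0) A (coord u).
  apply/ffunP => I; rewrite [LHS]ffunE [RHS]ffunE; apply: eq_Rintegral => t.
  rewrite in_setE /= in_itv /= => t01; rewrite /contraction dA //.
  exact: (eball_convex Bx0 (coord_eball u) t01).
have CA I : Ck B 1 (fun y => A y I) by exact: Ck_star_eta.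
have AE u : A (coord u) = star_eta a u by rewrite /A coordK.
have [H1 H2] := cone_homotopy_fixed Bx0 CA.
split=> [E|[E1 E2]].
  have [|F1 F2] := H1; first by move=> y By; rewrite -(pointK By) -hA -E AE.
  by split=> [u|]; rewrite -AE // F1 //; exact: coord_eball.
apply/funext => u; rewrite hA -AE; apply: H2; last exact: coord_eball.
by split=> [y By|]; rewrite ?AE // -(pointK By) AE.
Qed.

End Anticoexact.

Theorem proposition6 (R : realType) (n : nat) (hn : (1 <= n)%N)
    (U : star_region R n) (o : bool) (x0 : U)
    (g : 'M[Cinf U]_n) (hg : riemannian g) :
  GRing.submod_closed (anticoexact o x0 g).
Proof.
have P := anticoexactP hn o x0 hg.
split=> [|f a b /P[a1 a2] /P[b1 b2]]; apply/P.
  by split=> [u|]; rewrite star_eta0 ?linear0.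
split=> [u|]; rewrite star_etaP; last by rewrite a2 b2 scaler0 addr0.
by rewrite linearP /= a1 b1 scaler0 addr0.
Qed.
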